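(* Let $f\in\mathrm{Dom}_+(\Gamma)$. Suppose that (i) $f\to\infty$; (ii) there is an increasing (not necessarily strictly) function $g:[0,\infty)\to[0,\infty)$ such that $G(z):=\int_0^z\frac{dy}{g(y)}<\infty$ for all $z\ge0$ and $\lim_{z\to\infty}G(z)=\infty$; (iii) $\Gamma f(x)\le g(f(x))$ for all $x\in\mathbb X$. Then $\mathbb P_x(\zeta=+\infty)=1$ for all $x\in\mathbb X$.
   Context: Let $\mathbb X$ be a countably infinite set and $\Gamma=(\Gamma_{xy})_{x,y\in\mathbb X}$ a matrix with $\Gamma_{xy}\ge0$ for $y\ne x$, $\gamma_x:=\sum_{y\ne x}\Gamma_{xy}$, $\Gamma_{xx}=-\gamma_x$, and $0<\gamma_x<\infty$ for all $x$. Let $P_{xy}=\Gamma_{xy}/\gamma_x$ for $y\neq x$ and $P_{xx}=0$; the discrete-time chain $(\tilde\xi_n)$ with transition matrix $P$ (embedded jump chain) is assumed irreducible. The continuous-time Markov chain $(\xi_t)_{t\ge0}$ with generator $\Gamma$: conditionally on $\tilde\xi$, holding times $\sigma_n$ ($n\ge1$) are independent exponential with parameter $\gamma_{\tilde\xi_{n-1}}$; $J_0=0$, $J_n=\sigma_1+\dots+\sigma_n$; explosion time $\zeta=\lim_n J_n$; $\xi_t=\tilde\xi_n$ on $[J_n,J_{n+1})$ and $\xi_t=\partial$ (cemetery) for $t\ge\zeta$. $\mathbb P_x$ refers to $\xi_0=x$. $\mathrm{Dom}(\Gamma)=\{f:\mathbb X\to\mathbb R:\ \sum_{y\ne x}\Gamma_{xy}|f(y)|<\infty\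 \forall x\}$, $\mathrm{Dom}_+(\Gamma)$ its non-negative elements, $\Gamma f(x)=\sum_{y}\Gamma_{xy}f(y)$. ''$f\to\infty$'' means $\{x: f(x)\le n\}$ is finite for every $n\in\mathbb N$. *)

(* Defs.v *)
From HB Require Import structures.
From mathcomp Require Import all_boot all_order all_algebra.
From mathcomp Require Import all_classical all_reals all_analysis.
Set Implicit Arguments. Unset Strict Implicit. Unset Printing Implicit Defensive.
Import Order.TTheory GRing.Theory Num.Theory.
Import numFieldNormedType.Exports.
Local Open Scope classical_set_scope.
Local Open Scope ring_scope.

Section CTMC.
Variables (R : realType) (X : countType).

Definition gammaE (Gam : X -> X -> R) (x : X) : \bar R :=
  (\esum_(y in [set y | y != x]) (Gam x y)%:E)%E.

(* the real number gamma_x (meaningful when gammaE is finite) *)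
Definition gamma (Gam : X -> X -> R) (x : X) : R := fine (gammaE Gam x).

Definition Qmatrix (Gam : X -> X -> R) : Prop :=
  (forall x y, x != y -> 0 <= Gam x y) /\
  (forall x, (gammaE Gam x < +oo)%E) /\
  (forall x, 0 < gamma Gam x) /\
  (forall x, Gam x x = - gamma Gam x).

Definition jumpP (Gam : X -> X -> R) (x y : X) : R :=
  if y == x then 0 else Gam x y / gamma Gam x.

Definition irreducible (Gam : X -> X -> R) : Prop :=
  forall x y : X, exists (n : nat) (p : nat -> X),
    p 0%N = x /\ p n = y /\ forall k, (k < n)%N -> 0 < jumpP Gam (p k) (p k.+1).

Definition inDom (Gam : X -> X -> R) (f : X -> R) : Prop :=
  forall x, (\esum_(y in [set y | y != x]) (Gam x y * `|f y|)%:E < +oo)%E.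

Definition inDomPlus (Gam : X -> X -> R) (f : X -> R) : Prop :=
  inDom Gam f /\ forall x, 0 <= f x.

(* Gamma f (x) = sum_y Gamma_xy f(y) = sum_{y<>x} Gamma_xy f(y) - gamma_x f(x) *)
Definition genf (Gam : X -> X -> R) (f : X -> R) (x : X) : R :=
  fine (\esum_(y in [set y | y != x]) (Gam x y * f y)%:E)%E - gamma Gam x * f x.

Definition tends_to_infty (f : X -> R) : Prop :=
  forall n : nat, finite_set [set x | f x <= n%:R].

(* G(z) = int_0^z dy / g(y)  (1/0 = +oo in \bar R) *)
Definition Gint (g : R -> R) (z : R) : \bar R :=
  \int[lebesgue_measure]_(y in `[0, z]) ((g y)%:E)^-1%E.

(* (xi, sig) realizes the continuous-time chain with generator Gam started at x:
   xi n = tilde xi_n (jump chain), sig n = sigma_{n+1} (holding time in state xi n).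
   The joint law: for all n, states xs and thresholds ts >= 0,
   P(xi_k = xs k (k <= n), sig_k > ts k (k < n))
     = 1_{xs 0 = x} * prod_{k<n} P_{xs k, xs (k+1)} exp(-gamma_{xs k} ts k).
   This says xi is a Markov chain with matrix P from x and, conditionally on xi,
   the holding times are independent exponentials with parameters gamma_{xi_{k}}. *)
Definition is_CTMC (Gam : X -> X -> R) (x : X) d (Omega : measurableType d)
  (Pr : probability Omega R) (xi : nat -> Omega -> X) (sig : nat -> Omega -> R) : Prop :=
  (forall n y, measurable [set w | xi n w = y]) /\
  (forall n, measurable_fun setT (sig n)) /\
  (forall (n : nat) (xs : nat -> X) (ts : nat -> R),
     (forall k, 0 <= ts k) ->
     Pr ([set w | forall k, (k <= n)%N -> xi k w = xs k] `&`
         [set w | forall k, (k < n)%N -> ts k < sig k w]) =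
     ((if xs 0%N == x then 1 else 0) *
      \prod_(k < n) (jumpP Gam (xs k) (xs k.+1) * expR (- (gamma Gam (xs k) * ts k))))%:E).

End CTMC.

(* Main.v *)
(* Let s_j = 1 / (1 + g(j+1)) and let H be the concave function with slope s_j
   on [j, j+1] for j < N, constant beyond N.  By concavity V = H o f satisfies
   Gamma V <= 1, it is bounded, it equals its maximum K_N = s_0 + ... + s_(N-1)
   off a finite set, and K_N tends to infinity because G does.

   Fix a time horizon M >= 1.  The holding time s spent in x is penalised by a
   step function of s which dominates exp(-s) on ]0, M] and has mean q_x < 1.
   The product of the first n penalties is at least exp(-M) when J_n <= M, and
   its mean is the n-th iterate of u |-> q . P u at the constant 1.  With kappa > 0
   small, q_x (1 + kappa / gamma_x) <= 1, so that U = 1 + kappa V satisfies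
   q . P U <= U.  A maximum principle bounds the n-th iterate by
   U / (1 + kappa K_N) + rho^n, where rho < 1 is the maximum of q over the finite
   set {V <> K_N}.  Letting n and then N go to infinity gives P(zeta <= M) = 0. *)

Require Import Defs.
From HB Require Import structures.
From mathcomp Require Import all_boot all_order all_algebra.
From mathcomp Require Import all_classical all_reals all_analysis.
From mathcomp Require Import measurable_realfun.
From mathcomp Require Import lra ring.
Import Order.TTheory GRing.Theory Num.Theory.
Import numFieldNormedType.Exports.
Local Open Scope classical_set_scope.
Local Open Scope ring_scope.

(** * Countable sums and fibers *)

(** Each state is indexed by its code, and a number that is no code contributes 0; the rules for
    series thus become available for sums over [X]. *)
Lemma esum_pickle_inv (R : realType) (X : countType) (a : X -> \bar R) :
  (forall x, 0 <= a x)%E ->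
  \esum_(x in [set: X]) a x =
  (\sum_(i <oo) oapp a 0 (@pickle_inv X i))%E.
Proof.
move=> a0; rewrite nneseries_esumT; last first.
  by move=> i; case: (@pickle_inv X i) => //=.
rewrite (_ : \esum_(x in _) a x =
  \esum_(x in [set: X]) oapp a 0%E (@pickle_inv X (pickle x))); last first.
  by apply: eq_esum => x _; rewrite pickleK_inv.
rewrite -(esum_image [set: X] pickle (fun i => oapp a 0%E (@pickle_inv X i)));
  last by move=> x y _ _ /(pcan_inj pickleK_inv).
rewrite esum_mkcond; apply: eq_esum => i _.
case: ifPn => //; rewrite notin_setE /= => ni.
case E: (@pickle_inv X i) => [y|] //=; exfalso; apply: ni; exists y => //.
by have := @pickle_invK X i; rewrite /oapp E.
Qed.

Lemma esumZl (R : realType) (X : countType) (A : set X) (c : R)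
    (a : X -> \bar R) : 0 <= c -> (forall x, A x -> 0 <= a x)%E ->
  \esum_(x in A) (c%:E * a x)%E = (c%:E * \esum_(x in A) a x)%E.
Proof.
move=> c0 a0; rewrite esum_mkcond [in RHS]esum_mkcond.
rewrite !esum_pickle_inv -?nneseriesZl.
- by apply: eq_eseriesr => i _; case: (@pickle_inv X i) => //= [x|];
    [case: ifP => // _|]; rewrite mule0.
- by move=> i _; case: (@pickle_inv X i) => //= x; case: ifPn => // /set_mem /a0.
- by move=> x; case: ifPn => // /set_mem /a0.
- by move=> x; case: ifPn => // /set_mem /a0 ?; rewrite mule_ge0 ?lee_fin.
Qed.

(** Countable additivity over the fibers of [xi], numbered by the codes of their states. This total
    probability formula serves to split an integral by the next state. *)
Lemma ge0_integral_fiber (R : realType) (X : countType) d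
    (Omega : measurableType d) (mu : {measure set Omega -> \bar R})
    (xi : Omega -> X) (D : set Omega) (h : Omega -> \bar R) :
  (forall y, measurable [set w | xi w = y]) -> measurable D ->
  measurable_fun setT h -> (forall w, 0 <= h w)%E ->
  (\int[mu]_(w in D) h w =
   \esum_(y in [set: X]) \int[mu]_(w in D `&` [set w | xi w = y]) h w)%E.
Proof.
move=> mxi mD mh h0.
pose F i := D `&` [set w | pickle (xi w) = i].
have FE i : F i = oapp (fun y => D `&` [set w | xi w = y]) set0 (@pickle_inv X i).
  rewrite /F; case E: (@pickle_inv X i) => [y|] /=.
    have := @pickle_invK X i; rewrite /oapp E => <-.
    congr (_ `&` _); apply/seteqP; split=> w /= => [|->//].
    exact: (pcan_inj pickleK_inv).
  rewrite -subset0 => w [_ /= iE]; move: E; rewrite -iE pickleK_inv //.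
have mF i : measurable (F i).
  rewrite FE; case: (@pickle_inv X i) => //= y; exact: measurableI.
have DE : D = \bigcup_i F i.
  by apply/seteqP; split=> [w Dw|w [i _ []]//]; exists (pickle (xi w)).
rewrite {1}DE ge0_integral_bigcup//; last 2 first.
- exact: measurable_funTS.
- by move=> i j _ _ [w [[_ <-] [_ <-]]].
rewrite esum_pickle_inv; last by move=> y; apply: integral_ge0.
apply: eq_eseriesr => i _; rewrite FE; case: (@pickle_inv X i) => //=.
by rewrite integral_set0.
Qed.

Lemma measurable_forall d (T : measurableType d) (D : pred nat)
    (A : nat -> set T) : (forall k, measurable (A k)) ->
  measurable [set w | forall k, D k -> A k w].
Proof.
move=> mA.
rewrite (_ : mkset _ = \bigcap_k (if D k then A k else setT)).
  by apply: bigcapT_measurable => k; case: ifP.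
apply/seteqP; split=> w h k; first by move=> _; case: ifP => // /h.
by move=> Dk; have := h k Logic.I; rewrite Dk.
Qed.

(** * Mean of the penalties along the chain *)

Section damping.
Context (R : realType) (X : countType) (Gam : X -> X -> R) (a t : X -> R).

(* A step function of the holding time, so that products of such factors expand
   into finitely many of the tail events whose probability is_CTMC prescribes;
   [damp_mean] is its mean under the exponential law of parameter gamma_x. *)
Definition damp (x : X) (s : R) : R := (0 < s)%R%:R - a x * (t x < s)%R%:R.

Definition damp_mean (x : X) : R := 1 - a x * expR (- (gamma Gam x * t x)).

Definition damped_step (u : X -> \bar R) (x : X) : \bar R :=
  \esum_(y in [set: X]) ((damp_mean x * jumpP Gam x y)%:E * u y)%E.

Context (x0 : X) d (Omega : measurableType d) (Pr : probability Omega R)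
  (xi : nat -> Omega -> X) (sig : nat -> Omega -> R).
Hypothesis chain : is_CTMC Gam x0 Pr xi sig.
Hypothesis t_ge0 : forall x, 0 <= t x.

Definition path_event (xs : nat -> X) (n : nat) : set Omega :=
  [set w | forall k, (k <= n)%N -> xi k w = xs k].

Definition discount (n : nat) (w : Omega) : R :=
  \prod_(k < n) damp (xi k w) (sig k w).

Lemma measurable_path_event xs n : measurable (path_event xs n).
Proof.
have [mxi _] := chain.
exact: (@measurable_forall _ _ (fun k => k <= n)%N
  (fun k => [set w | xi k w = xs k])).
Qed.

Lemma measurable_late k (c : R) : measurable [set w | c < sig k w].
Proof.
case: chain => _ [msig _]; rewrite -[X in measurable X]setTI.
have := msig k measurableT `]c, +oo[%classic (measurable_itv _).
by congr measurable; congr (_ `&` _); apply/seteqP; split=> w /=;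
  rewrite in_itv /= andbT.
Qed.

(** Each [b] selects one tail event, with threshold 0 or [t x], so that a product of penalties
    expands over Boolean vectors. *)
Lemma damp_sum x s : damp x s =
  \sum_(b : bool) (if b then - a x else 1) * ((if b then t x else 0) < s)%R%:R.
Proof. by rewrite big_bool /= mul1r mulNr addrC. Qed.

Lemma damp_mean_sum x : damp_mean x =
  \sum_(b : bool) (if b then - a x else 1) *
    expR (- (gamma Gam x * (if b then t x else 0))).
Proof. by rewrite big_bool /= mulr0 oppr0 expR0 mul1r mulNr addrC. Qed.

(** After the expansion each Boolean vector contributes the probability of one joint tail event,
    which the law of the chain gives; the sum then factors back into a product of means. *)
Lemma integral_discount_path n xs :
  (\int[Pr]_(w in path_event xs n) (discount n w)%:E =
   ((if xs 0%N == x0 then 1 else 0) *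
    \prod_(k < n) (damp_mean (xs k) * jumpP Gam (xs k) (xs k.+1)))%:E)%E.
Proof.
(* The law asks for a threshold at every index; from [n] on the default is 0. *)
pose thr (b : {ffun 'I_n -> bool}) (k : nat) : R :=
  if insub k is Some i then if b i then t (xs i) else 0 else 0.
pose coef (b : {ffun 'I_n -> bool}) : R :=
  \prod_(k < n) (if b k then - a (xs k) else 1).
pose D b : set Omega := [set w | forall k, (k < n)%N -> thr b k < sig k w].
have thrE b (k : 'I_n) : thr b (val k) = if b k then t (xs k) else 0.
  by rewrite /thr valK.
have thr_ge0 b k : 0 <= thr b k.
  by rewrite /thr; case: insub => // i; case: ifP.
have mC := measurable_path_event xs n.
have mD b : measurable (D b).
  by rewrite /D; apply: (@measurable_forall _ _ (fun k => k < n)%N (fun k => [set w | thr b k < sig k w])) => k; exact: measurable_late.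
have discE w : path_event xs n w ->
    discount n w = \sum_b coef b * \1_(D b) w.
  move=> Cw; rewrite /discount.
  under eq_bigr => k _ do rewrite (Cw k (ltnW (ltn_ord k))) damp_sum.
  rewrite bigA_distr_bigA /=; apply: eq_bigr => b _.
  rewrite big_split /=; congr (_ * _); rewrite indicE.
  under eq_bigr => k _ do rewrite -thrE.
  case: (boolP (w \in D b)) => [/set_mem Dw|].
    by rewrite big1// => k _; rewrite (Dw k (ltn_ord k)).
  rewrite notin_setE => nDw.
  have /existsP[k nk] : [exists k : 'I_n, ~~ (thr b k < sig k w)].
    apply: contrapT => /negP; rewrite negb_exists => /forallP h; apply: nDw.
    by move=> k lt_kn; have := h (Ordinal lt_kn); rewrite negbK.
  by rewrite (bigD1 k)//= (negbTE nk) mul0r.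
have PrD b : Pr (D b `&` path_event xs n) =
   ((if xs 0%N == x0 then 1 else 0) * \prod_(k < n) (jumpP Gam (xs k) (xs k.+1) *
    expR (- (gamma Gam (xs k) * thr b k))))%:E.
  by have [_ [_ law]] := chain; rewrite setIC; exact: law.
rewrite (eq_integral (fun w => \sum_b (coef b * \1_(D b) w)%:E)%E); last first.
  by move=> w /set_mem /discE ->; rewrite sumEFin.
(* The coefficients have mixed signs, so linearity of the integral rests on integrability. *)
have intD b : Pr.-integrable (path_event xs n) (EFin \o \1_(D b)).
  by apply: (integrableS measurableT) => //; exact: integrable_indic.
rewrite integral_sum//; last first.
  move=> b; under eq_fun do rewrite EFinM.
  exact: (integrableZl mC (coef b) (intD b)).
transitivity (\sum_(b : {ffun 'I_n -> bool}) (coef b * ((if xs 0%N == x0 then 1 else 0) *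
  \prod_(k < n) (jumpP Gam (xs k) (xs k.+1) *
    expR (- (gamma Gam (xs k) * thr b k)))))%:E)%E.
  apply: eq_bigr => b _; under eq_integral do rewrite EFinM.
  rewrite (integralZl mC (intD b)) /= integral_indic// EFinM; congr (_ * _)%E.
  exact: PrD.
rewrite sumEFin; congr EFin.
under eq_bigr => b _ do rewrite mulrCA -big_split /=.
rewrite -mulr_sumr; congr (_ * _).
under [RHS]eq_bigr => k _ do rewrite damp_mean_sum mulr_suml.
rewrite bigA_distr_bigA /=; apply: eq_bigr => b _; apply: eq_bigr => k _.
by rewrite thrE -mulrA; congr (_ * _); rewrite mulrC.
Qed.

Hypothesis a_ge0 : forall x, 0 <= a x.
Hypothesis a_le1 : forall x, a x <= 1.
Hypothesis Gam_Q : Qmatrix Gam.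

Lemma gamma_gt0 x : 0 < gamma Gam x.
Proof. by case: Gam_Q => _ [_ []]. Qed.

Lemma jumpP_ge0 x y : 0 <= jumpP Gam x y.
Proof.
rewrite /jumpP; case: eqP => // /eqP yx; case: Gam_Q => Gam_ge0 _.
by rewrite divr_ge0// ?Gam_ge0 1?eq_sym// ltW// gamma_gt0.
Qed.

Lemma damp_ge0 x s : 0 <= damp x s.
Proof.
rewrite /damp subr_ge0; case: (ltP (t x) s) => ts; last by rewrite mulr0.
by rewrite (le_lt_trans (t_ge0 x) ts) mulr1.
Qed.

Lemma damp_mean_ge0 x : 0 <= damp_mean x.
Proof.
rewrite /damp_mean subr_ge0 mulr_ile1 ?expR_ge0//.
by rewrite expR_le1 oppr_le0 mulr_ge0// ltW// gamma_gt0.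
Qed.

Lemma discount_ge0 n w : 0 <= discount n w.
Proof. by apply: prodr_ge0 => k _; exact: damp_ge0. Qed.

(** [X] carries no sigma-algebra: the preimage of [B] is written as the countable union of the
    fibers over the states [y] with [c y] in [B]. *)
Lemma measurable_state (c : X -> R) k : measurable_fun setT (fun w => c (xi k w)).
Proof.
move=> _ B _; rewrite setTI.
rewrite (_ : _ @^-1` _ = \bigcup_i
    oapp (fun y => if `[< B (c y) >] then [set w | xi k w = y] else set0) set0
      (pickle_inv i)).
  apply: bigcupT_measurable => i; case: (pickle_inv i) => //= y.
  by case: ifP => // _; have [mxi _] := chain; exact: mxi.
apply/seteqP; split=> [w Bw|w [i _]].
  by exists (pickle (xi k w)) => //; rewrite pickleK_inv /= asboolT.
by case: (pickle_inv i) => //= y; case: asboolP => [By /= yw|_ []]; rewrite /= yw.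
Qed.

Lemma measurable_natb (b : Omega -> bool) : measurable_fun setT b ->
  measurable_fun setT (fun w => (b w)%:R : R).
Proof.
move=> mb; rewrite (_ : (fun w => _) = (fun w => if b w then 1 else 0 : R)).
  exact: measurable_fun_ifT.
by apply/funext => w; case: (b w).
Qed.

Lemma measurable_discount n : measurable_fun setT (discount n).
Proof.
apply: measurable_prod => k _; have [_ [msig _]] := chain.
apply: measurable_funB; first by apply: measurable_natb; exact: measurable_fun_ltr.
apply: measurable_funM; first exact: measurable_state.
by apply: measurable_natb; apply: measurable_fun_ltr => //; exact: measurable_state.
Qed.

Lemma damped_step_ge0 u x : (forall y, 0 <= u y)%E -> (0 <= damped_step u x)%E.
Proof.
move=> u0; apply: esum_ge0 => y _; rewrite mule_ge0// lee_fin.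
by rewrite mulr_ge0 ?damp_mean_ge0 ?jumpP_ge0.
Qed.

Lemma iter_damped_step_ge0 n x : (0 <= iter n damped_step (cst 1%E) x)%E.
Proof. by elim: n x => //= n IHn x; exact: damped_step_ge0. Qed.

(** Markov property by induction on the number of steps after the prefix: splitting by the state at
    time [j.+1] lengthens the prefix and accounts for one application of [damped_step]. *)
Lemma integral_discount_prefix m j xs :
  (\int[Pr]_(w in path_event xs j) (discount (j + m) w)%:E =
   ((if xs 0%N == x0 then 1 else 0) *
    \prod_(k < j) (damp_mean (xs k) * jumpP Gam (xs k) (xs k.+1)))%:E *
   iter m damped_step (cst 1) (xs j))%E.
Proof.
elim: m j xs => [|m IHm] j xs.
  by rewrite addn0 integral_discount_path /= mule1.
have [mxi _] := chain.
rewrite (@ge0_integral_fiber _ _ _ _ Pr (xi j.+1))//; last 3 first.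
- exact: measurable_path_event.
- exact/measurable_EFinP/measurable_discount.
- by move=> w; rewrite lee_fin discount_ge0.
pose ext y k := if k == j.+1 then y else xs k.
have extE y k : (k <= j)%N -> ext y k = xs k.
  by rewrite /ext => kj; rewrite ltn_eqF.
rewrite /= /damped_step -esumZl; last 2 first.
- rewrite mulr_ge0//; first by case: ifP.
  by apply: prodr_ge0 => k _; rewrite mulr_ge0 ?damp_mean_ge0 ?jumpP_ge0.
- move=> y _; rewrite mule_ge0 ?iter_damped_step_ge0// lee_fin.
  by rewrite mulr_ge0 ?damp_mean_ge0 ?jumpP_ge0.
apply: eq_esum => y _.
rewrite (_ : _ `&` _ = path_event (ext y) j.+1); last first.
  apply/seteqP; split=> [w [Cw /= yw] k|w Cw].
    by rewrite leq_eqVlt ltnS => /predU1P[->|kj];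
      [rewrite /ext eqxx|rewrite extE// Cw].
  split=> [k kj|/=]; first by rewrite Cw ?extE// ltnW.
  by rewrite Cw// /ext eqxx.
rewrite -addSnnS IHm extE// big_ord_recr /= muleA -EFinM.
rewrite (extE _ j)// (_ : ext y j.+1 = y); last by rewrite /ext eqxx.
under eq_bigr => k _ do rewrite !extE// 1?ltnW//.
by rewrite mulrA.
Qed.

Lemma integral_discount n :
  (\int[Pr]_w (discount n w)%:E = iter n damped_step (cst 1) x0)%E.
Proof.
have [mxi _] := chain.
rewrite (@ge0_integral_fiber _ _ _ _ Pr (xi 0%N))//; last 2 first.
- exact/measurable_EFinP/measurable_discount.
- by move=> w; rewrite lee_fin discount_ge0.
rewrite -[RHS](esum_set1 (a := iter n damped_step (cst 1%E)))//;
  last exact: iter_damped_step_ge0.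
rewrite [RHS]esum_mkcond; apply: eq_esum => y _.
rewrite setTI (_ : mkset _ = path_event (fun=> y) 0); last first.
  by apply/seteqP; split=> [w /= <- [|]//|w /= ->].
have := integral_discount_prefix n 0 (fun=> y); rewrite add0n => ->.
rewrite big_ord0 mulr1 in_set1.
by case: eqVneq => [->|_]; rewrite ?mul1e ?mul0e.
Qed.

End damping.

Arguments damp {R X}.
Arguments damp_mean {R X}.
Arguments damped_step {R X}.
Arguments discount {R X} a t {d Omega}.

(** * Concave functions with prescribed slopes *)

Section clipped_sums.
Context (R : realType).

Definition clip (j : nat) (z : R) : R := Num.min (Num.max (z - j%:R) 0) 1.

(** For z >= 0, [clip j z] is the length of the part of [j, j+1] below z, so this is the integral
    over [0, z] of the step function equal to [s j] on [j, j+1[ for j < N and to 0 beyond N. *)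
Definition clip_sum (s : nat -> R) (N : nat) (z : R) : R :=
  \sum_(j < N) s j * clip j z.

Lemma clip_ge0 j z : 0 <= clip j z.
Proof. by rewrite /clip le_min ler01 le_max lexx orbT. Qed.

Lemma clip_le1 j z : clip j z <= 1.
Proof. by rewrite /clip ge_min lexx orbT. Qed.

Lemma clip_eq1 j z : j.+1%:R <= z -> clip j z = 1.
Proof. by rewrite -natr1 => h; apply/min_idPr; rewrite le_max lerBrDl h. Qed.

Lemma clip_eq0 j z : z <= j%:R -> clip j z = 0.
Proof.
move=> h; rewrite /clip; have /max_idPr -> : z - j%:R <= 0 by rewrite subr_le0.
by apply/min_idPl; exact: ler01.
Qed.

Lemma sum_clip N z : 0 <= z -> \sum_(j < N) clip j z = Num.min z N%:R.
Proof.
move=> z0; elim: N => [|N IHN]; first by rewrite big_ord0; apply/esym/min_idPr.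
rewrite big_ord_recr /= IHN -natr1 /clip.
case: (leP z N%:R) => zN.
  rewrite (max_idPr _) ?subr_le0// (min_idPl _)// addr0.
  by apply/esym/min_idPl; rewrite (le_trans zN)// lerDl.
rewrite (max_idPl _) ?subr_ge0 ?ltW// addr_minr addrC subrK.
by rewrite minC.
Qed.

Variable s : nat -> R.
Hypothesis s_ge0 : forall j, 0 <= s j.
Hypothesis s_le1 : forall j, s j <= 1.
Hypothesis s_decr : forall i j, (i <= j)%N -> s j <= s i.

Lemma clip_sum_ge0 N z : 0 <= clip_sum s N z.
Proof. by apply: sumr_ge0 => j _; rewrite mulr_ge0 ?clip_ge0. Qed.

Lemma clip_sum_le N z : 0 <= z -> clip_sum s N z <= z.
Proof.
move=> z0; apply: (@le_trans _ _ (\sum_(j < N) clip j z)).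
  by apply: ler_sum => j _; rewrite ler_piMl ?clip_ge0.
by rewrite sum_clip// ge_min lexx.
Qed.

Lemma clip_sum_max N z : N%:R <= z -> clip_sum s N z = \sum_(j < N) s j.
Proof.
move=> Nz; apply: eq_bigr => j _; rewrite clip_eq1 ?mulr1//.
by rewrite (le_trans _ Nz)// ler_nat.
Qed.

(** Concavity: the slope just to the right of [x] supports the graph. It is [s m] when m < N and 0
    once the maximum is reached, hence only an upper bound on [c]. *)
Lemma clip_sum_superdifferential N (x : R) : 0 <= x ->
  exists c, [/\ 0 <= c, c <= s (Num.truncn x) &
    forall y, 0 <= y -> clip_sum s N y <= clip_sum s N x + c * (y - x)].
Proof.
move=> x0; have /andP[mx xm] := truncn_itv x0; set m := Num.truncn x in mx xm *.
have [mN|Nm] := ltnP m N; last first.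
  exists 0; split => // y y0; rewrite mul0r addr0.
  rewrite [leRHS]clip_sum_max; last by rewrite (le_trans _ mx)// ler_nat.
  by apply: ler_sum => j _; rewrite ler_piMr ?clip_le1.
exists (s m); split => // y y0; rewrite -lerBlDl /clip_sum -sumrB.
apply: (@le_trans _ _ (\sum_(j < N) s m * (clip j y - clip j x))); last first.
  rewrite -mulr_sumr sumrB !sum_clip// (_ : Num.min x _ = x); last first.
    by apply/min_idPl; rewrite (le_trans (ltW xm))// ler_nat.
  by rewrite ler_wpM2l// lerD2r ge_min lexx.
(* Below [m] the increment is nonpositive and [s j] is at least [s m]; above [m] it is nonnegative
   and [s j] is at most [s m]. Either way, replacing the slope by [s m] does not decrease the
   term. *)
apply: ler_sum => j _; rewrite -mulrBr.
case: (ltngtP j m) => [jm|mj|->//].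
  rewrite (@clip_eq1 j x); last by rewrite (le_trans _ mx)// ler_nat.
  by rewrite ler_wnM2r ?subr_le0 ?clip_le1 ?s_decr// ltnW.
rewrite (@clip_eq0 j x); last by rewrite (le_trans (ltW xm))// ler_nat.
by rewrite ler_wpM2r ?subr0 ?clip_ge0 ?s_decr// ltnW.
Qed.

End clipped_sums.

(** * Divergence of the sum of the slopes *)

Section divergence.
Context (R : realType) (g : R -> R).
Hypothesis g_ge0 : forall y : R, 0 <= y -> 0 <= g y.
Hypothesis g_incr : forall a b : R, 0 <= a -> a <= b -> g a <= g b.
Hypothesis Gint_fin : forall z : R, 0 <= z -> (Gint g z < +oo)%E.
Hypothesis Gint_infty : Gint g @ +oo --> +oo%E.

(** A zero of [g] at [y] would, by monotonicity, make the integrand infinite on all of [0, y]. *)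
Lemma g_gt0 y : 0 < y -> 0 < g y.
Proof.
move=> y0; rewrite lt_neqAle g_ge0 ?ltW// andbT eq_sym; apply/eqP => gy0.
have := Gint_fin _ (ltW y0); rewrite /Gint.
rewrite (eq_integral (cst +oo%E)); last first.
  move=> z /set_mem /=; rewrite in_itv /= => /andP[z0 zy].
  rewrite inver ifT// eq_le -{1}gy0 g_incr//= g_ge0//.
rewrite integral_cst//= lebesgue_measure_itv /= lte_fin y0.
by rewrite sube0 gt0_mulye// lte_fin.
Qed.

(** Composing with max(0, y) extends [g] to a monotone, hence measurable, function on the line; the
    zeros of [g], where the inverse is infinite, are split off. *)
Lemma measurable_inv_g (D : set R) : measurable D -> D `<=` [set y | 0 <= y] ->
  measurable_fun D (fun y => ((g y)%:E)^-1%E).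
Proof.
move=> mD D0; pose k (y : R) : R := g (Num.max 0 y).
have mk : measurable_fun setT k.
  apply: nondecreasing_measurable => // y z yz; apply: g_incr.
    by rewrite le_max lexx.
  by rewrite ge_max !le_max lexx /= yz orbT.
apply: (eq_measurable_fun
    (fun y => if k y == 0 then +oo%E else ((k y `^ (-1))%R)%:E)).
  move=> y /set_mem /D0 /= y0; rewrite inver /k (max_idPr y0).
  by rewrite powR_inv1 ?g_ge0.
apply: measurable_funTS; apply: measurable_fun_ifT => //=.
  exact: measurable_fun_eqr.
by apply/measurable_EFinP; apply: (measurableT_comp (measurable_powR _)).
Qed.

Lemma Gint_step z : 0 < z -> (Gint g (z + 1) <= Gint g z + ((g z)^-1)%:E)%E.
Proof.
move=> z0.
have inv_ge0 y : 0 <= y -> (0 <= ((g y)%:E)^-1)%E.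
  by move=> y0; rewrite inve_ge0 lee_fin g_ge0.
rewrite /Gint (_ : `[0, z + 1]%classic = `[0, z] `|` `]z, z + 1]); last first.
  apply/seteqP; split=> y /=; rewrite !in_itv /=; last first.
    by move=> [|] /andP[? ?]; apply/andP; split; lra.
  by move=> /andP[y0 yz]; case: (leP y z) => ?; [left|right]; apply/andP; split.
rewrite ge0_integral_setU//=.
- rewrite leeD2l// (@le_trans _ _ (\int[lebesgue_measure]_(y in `]z, (z + 1)%R]) cst ((g z)^-1)%:E y)%E)//.
    apply: ge0_le_integral => //=.
    + by move=> y; rewrite in_itv /= => /andP[zy _]; apply: inv_ge0; lra.
    + by apply: measurable_inv_g => // y /=; rewrite in_itv /= => /andP[zy _]; lra.
    + move=> y; rewrite in_itv /= => /andP[zy _].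
      have y0 : 0 < y by lra.
      rewrite inver gt_eqF ?g_gt0// lee_fin lef_pV2 ?posrE ?g_gt0//.
      by apply: g_incr; lra.
  rewrite integral_cst//= lebesgue_measure_itv /= lte_fin ltrDl ltr01.
  by rewrite -EFinB addrAC subrr add0r mule1.
- apply: measurable_inv_g; first exact: measurableU.
  by move=> y /= [|]; rewrite in_itv /= => /andP[]; lra.
- by move=> y [|] /=; rewrite in_itv /= => /andP[? ?]; apply: inv_ge0; lra.
- rewrite disj_set2E; apply/eqP/seteqP; split => y //= [].
  by rewrite !in_itv /= => /andP[? ?] /andP[? ?]; lra.
Qed.

Lemma slopes_diverge (B : R) : exists N,
  B <= \sum_(j < N) (1 + g j.+1%:R)^-1.
Proof.
have g1 : 0 < g 1 by exact: g_gt0.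
(* Since g(j) >= g(1) for j >= 1, this constant gives 1/g(j) <= c / (1 + g(j)). *)
set c := 1 + (g 1)^-1.
have c0 : 0 < c by rewrite addr_gt0 ?invr_gt0.
have G_le N : (Gint g N.+1%:R <=
    Gint g 1 + (c * \sum_(j < N) (1 + g j.+1%:R)^-1)%:E)%E.
  elim: N => [|N IHN]; first by rewrite big_ord0 mulr0 adde0.
  rewrite -natr1 (le_trans (Gint_step _ _))//.
  rewrite big_ord_recr /= mulrDr EFinD addeA leeD// lee_fin.
  have gN : g 1 <= g N.+1%:R by apply: g_incr => //; rewrite ler1n.
  have gN0 : 0 < g N.+1%:R by exact: lt_le_trans gN.
  rewrite ler_pdivlMr ?addr_gt0// mulrC mulrDl mul1r divff ?gt_eqF//.
  by rewrite addrC lerD2l lef_pV2 ?posrE.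
have G1 : Gint g 1 \is a fin_num.
  rewrite ge0_fin_numE ?Gint_fin//; apply: integral_ge0 => y /=.
  by rewrite in_itv /= => /andP[y0 _]; rewrite inve_ge0 lee_fin g_ge0.
have [M [_ HM]] := cvgey_ge Gint_infty (fine (Gint g 1) + c * B).
have [N MN] : exists N, M < N.+1%:R.
  exists (Num.truncn M); exact: truncnS_gt.
exists N; have := HM _ MN.
move=> /le_trans /(_ (G_le N)); rewrite -(fineK G1) /= -EFinD lee_fin.
by rewrite lerD2l ler_pM2l.
Qed.

End divergence.

(** * The Lyapunov function *)

Section generator.
Context (R : realType) (X : countType) (Gam : X -> X -> R).
Hypothesis Gam_Q : Qmatrix Gam.

Lemma gammaEE x : gammaE Gam x = (gamma Gam x)%:E.
Proof.
have [Gam_ge0 [fin _]] := Gam_Q; rewrite /gamma fineK// ge0_fin_numE//.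
by apply: esum_ge0 => y /= yx; rewrite lee_fin Gam_ge0// eq_sym.
Qed.

Lemma esum_jumpP (u : X -> \bar R) x : (forall y, 0 <= u y)%E ->
  (\esum_(y in [set: X]) (jumpP Gam x y)%:E * u y =
   ((gamma Gam x)^-1)%:E * \esum_(y in [set y | y != x]) (Gam x y)%:E * u y)%E.
Proof.
move=> u0; have [Gam_ge0 [_ [gam_gt0 _]]] := Gam_Q.
rewrite -esumZl; last 2 first.
- by rewrite invr_ge0 ltW.
- by move=> y /= yx; rewrite mule_ge0// lee_fin Gam_ge0// eq_sym.
rewrite [RHS]esum_mkcond; apply: eq_esum => y _; rewrite /jumpP.
case: eqVneq => [->|yx].
  by rewrite mul0e ifF//; apply/negbTE; rewrite notin_setE /= eqxx.
by rewrite ifT ?mem_set// muleA -EFinM mulrC.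
Qed.

(** Dividing the hypothesis by gamma_x gives P V <= V + 1 / gamma_x, and P fixes constants. The
    hypothesis is Gamma V <= 1 without subtraction, so the sum can stay in the extended reals. *)
Lemma damped_step_affine (a t : X -> R) (V : X -> R) (b c : R) (x : X) :
  0 <= damp_mean Gam a t x -> 0 <= b -> 0 <= c -> (forall y, 0 <= V y) ->
  (\esum_(y in [set y | y != x]) (Gam x y * V y)%:E
     <= (gamma Gam x * V x + 1)%:E)%E ->
  (damped_step Gam a t (fun y => (b * V y + c)%:E) x <=
   (damp_mean Gam a t x * (b * (V x + (gamma Gam x)^-1) + c))%:E)%E.
Proof.
move=> q0 b0 c0 V0 HV; have [Gam_ge0 [_ [gam_gt0 _]]] := Gam_Q.
have G0 y : y != x -> 0 <= Gam x y by move=> yx; rewrite Gam_ge0// eq_sym.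
have bVc0 y : (0 <= (b * V y + c)%:E)%E by rewrite lee_fin addr_ge0 ?mulr_ge0.
rewrite /damped_step.
under eq_esum => y _ do rewrite EFinM -muleA.
rewrite esumZl//; last first.
  by move=> y _; rewrite mule_ge0// lee_fin jumpP_ge0.
rewrite EFinM lee_wpmul2l ?lee_fin// esum_jumpP//.
rewrite lee_pdivrMl//.
under eq_esum => y _ do rewrite -EFinM mulrDr mulrCA EFinD EFinM.
rewrite esumD; last 2 first.
- by move=> y /= /G0 ?; rewrite mule_ge0 ?lee_fin ?mulr_ge0.
- by move=> y /= /G0 ?; rewrite lee_fin mulr_ge0.
rewrite esumZl//; last by move=> y /= /G0 ?; rewrite lee_fin mulr_ge0.
under [X in (_ + X)%E]eq_esum => y _ do rewrite mulrC EFinM.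
rewrite esumZl//.
rewrite -/(gammaE Gam x) gammaEE.
have bE : (0 <= b%:E)%E by rewrite lee_fin.
apply: (le_trans (leeD2r _ (lee_wpmul2l bE HV))).
rewrite -!EFinM -EFinD lee_fin le_eqVlt; apply/orP; left; apply/eqP.
by field; rewrite gt_eqF.
Qed.

(** The supporting line of slope [c] at f(x), weighted by Gamma_xy and summed, bounds Gamma (H o
    f)(x) by c Gamma f(x) <= c g(f(x)) <= 1. *)
Lemma gen_clip_sum (f : X -> R) (s : nat -> R) (N : nat) (g : R -> R) (x : X) :
  inDomPlus Gam f -> genf Gam f x <= g (f x) ->
  (forall j, 0 <= s j) -> (forall i j, (i <= j)%N -> s j <= s i) ->
  (forall z, 0 <= z -> s (Num.truncn z) * g z <= 1) -> 0 <= g (f x) ->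
  (\esum_(y in [set y | y != x]) (Gam x y * clip_sum R s N (f y))%:E
     <= (gamma Gam x * clip_sum R s N (f x) + 1)%:E)%E.
Proof.
move=> [f_dom f_ge0] genf_le s_ge0 s_decr s_g g0.
have [Gam_ge0 [_ [gam_gt0 _]]] := Gam_Q.
have G0 y : y != x -> 0 <= Gam x y by move=> yx; rewrite Gam_ge0// eq_sym.
have [c [c0 cs super]] := clip_sum_superdifferential R s s_ge0 s_decr N _ (f_ge0 x).
pose S := (\esum_(y in [set y | y != x]) (Gam x y * f y)%:E)%E.
have SE : S = (fine S)%:E.
  rewrite fineK// ge0_fin_numE; last first.
    by apply: esum_ge0 => y /= /G0 ?; rewrite lee_fin mulr_ge0.
  by have := f_dom x; under eq_esum => y _ do rewrite ger0_norm//.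
have H0 y : 0 <= clip_sum R s N (f y) by exact: clip_sum_ge0.
(* The negative term -c f(x) is moved to the left, so that all sums have nonnegative terms and can
   be split. *)
have key : (\esum_(y in [set y | y != x]) (Gam x y * clip_sum R s N (f y))%:E
    + (c * f x)%:E * gammaE Gam x <=
    (clip_sum R s N (f x))%:E * gammaE Gam x + c%:E * S)%E.
  rewrite /gammaE -!esumZl//; last 2 first.
  - by move=> y /= /G0 ?; rewrite lee_fin mulr_ge0.
  - by rewrite mulr_ge0.
  rewrite -!esumD; first last.
  - by move=> y /= /G0 ?; rewrite mule_ge0 ?lee_fin ?mulr_ge0.
  - by move=> y /= /G0 ?; rewrite lee_fin mulr_ge0.
  - by move=> y /= /G0 ?; rewrite mule_ge0 ?lee_fin ?mulr_ge0.
  - by move=> y /= /G0 ?; rewrite mule_ge0 ?lee_fin.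
  apply: le_esum => y /= /G0 Gxy; rewrite -!EFinM -!EFinD lee_fin.
  have := ler_wpM2l Gxy (super _ (f_ge0 y)); nra.
move: key; rewrite gammaEE SE -!EFinM -EFinD.
rewrite -leeBrDr// -EFinB => /le_trans; apply; rewrite lee_fin.
have : c * g (f x) <= 1 by rewrite (le_trans _ (s_g _ (f_ge0 x)))// ler_wpM2r.
have := ler_wpM2l c0 genf_le; rewrite /genf -/S.
set F := fine S; set h := clip_sum _ _ _ _; nra.
Qed.

End generator.

(** * Penalty parameters as functions of the jump rate *)

Section damping_parameters.
Context (R : realType) (M : R).
Hypothesis M_ge1 : 1 <= M.

Let M_gt0 : 0 < M. Proof. exact: lt_le_trans M_ge1. Qed.

(* At low rates the penalty is the indicator of s <= M: its mean must be O(r) as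
   r tends to 0 because q_x (1 + kappa / gamma_x) <= 1 is needed. *)
Definition amplitude (r : R) : R := if r <= 1 then 1 else 1 - expR (- r^-1).

(** At rates above 1 the step sits at the mean holding time 1/r, where the penalty drops from 1 to
    exp(-1/r). *)
Definition threshold (r : R) : R := if r <= 1 then M else r^-1.

Definition mean_factor (r : R) : R :=
  1 - amplitude r * expR (- (r * threshold r)).

(** Small enough for both regimes: kappa M = exp(-M) / 2 serves the low rates, kappa <= exp(-1) / 2
    the high ones. *)
Definition kappa : R := expR (- M) / (2 * M).

Lemma kappa_gt0 : 0 < kappa.
Proof. by rewrite divr_gt0 ?expR_gt0// mulr_gt0. Qed.

Lemma amplitude_gt0 r : 0 < r -> 0 < amplitude r.
Proof.
move=> r0; rewrite /amplitude; case: ifP => // _.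
by rewrite subr_gt0 expR_lt1 oppr_lt0 invr_gt0.
Qed.

Lemma amplitude_le1 r : amplitude r <= 1.
Proof. by rewrite /amplitude; case: ifP => // _; rewrite gerBl expR_ge0. Qed.

Lemma threshold_ge0 r : 0 < r -> 0 <= threshold r.
Proof.
move=> r0; rewrite /threshold; case: ifP => _; first exact: ltW.
by rewrite invr_ge0 ltW.
Qed.

Lemma mean_factor_lt1 r : 0 < r -> mean_factor r < 1.
Proof. by move=> r0; rewrite gtrBl mulr_gt0 ?amplitude_gt0 ?expR_gt0. Qed.

Lemma mean_factor_kappa r : 0 < r -> mean_factor r * (1 + kappa / r) <= 1.
Proof.
move=> r0; rewrite /mean_factor /amplitude /threshold /kappa.
have EM0 := expR_gt0 (- M); set EM := expR (- M) in EM0 *.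
have M0 := M_gt0.
case: ifPn => [r1|]; last rewrite -ltNge => r1.
  (* Low rates: 1 - e <= r M bounds (1 - e) kappa / r by exp(-M) / 2, which is less than e. *)
  rewrite mul1r; set e := expR _.
  have e_ge : 1 - r * M <= e by apply: expR_ge1Dx.
  have EMe : EM <= e by rewrite ler_expR lerN2 ler_piMl// ltW.
  have e1 : e <= 1 by rewrite expR_le1 oppr_le0 mulr_ge0// ltW.
  have : (1 - e) * (EM / (2 * M) / r) <= r * M * (EM / (2 * M) / r).
    apply: ler_wpM2r; last by lra.
    by rewrite !divr_ge0 ?mulr_ge0// ltW.
  rewrite (_ : r * M * _ = EM / 2); last by field; rewrite !gt_eqF.
  lra.
(* High rates, with u = 1/r: the mean is 1 - (1 - E) e <= 1 - u e / 2, while kappa u <= u e / 2. *)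
rewrite mulfV ?gt_eqF// -[_ / r]/(_ * r^-1); set u := r^-1.
have u0 : 0 < u by rewrite invr_gt0.
have u1 : u <= 1 by rewrite invf_le1// ltW.
have E0 := expR_gt0 (- u); set E := expR (- u) in E0 *.
have Eu : E * (1 + u) <= 1.
  apply: (@le_trans _ _ (E * expR u)); first by rewrite ler_pM2l// expR_ge1Dx.
  by rewrite -expRD addNr expR0.
have e1 : EM <= expR (- 1) by rewrite ler_expR lerN2.
set e := expR (- 1) in e1 *.
have k_le : EM / (2 * M) <= e / 2.
  rewrite ler_pdivrMr ?mulr_gt0//.
  have : e * 1 <= e * M by rewrite ler_pM2l// expR_gt0.
  by move: e1; lra.
have k0 : 0 <= EM / (2 * M) by rewrite divr_ge0 ?mulr_ge0// ltW.
set k := EM / (2 * M) in k_le k0 *.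
have e0 : 0 < e := expR_gt0 _.
(* From E (1 + u) <= 1 and u <= 1: 1 - E >= u / (1 + u) >= u / 2. *)
have Eu2 : u / 2 <= 1 - E by nra.
have h1 : (1 - E) * e >= u / 2 * e by rewrite ler_pM2r.
have ku : k * u <= e / 2 * u by rewrite ler_pM2r.
have ku0 : 0 <= k * u by rewrite mulr_ge0// ltW.
have : (1 - (1 - E) * e) * (1 + k * u) <= (1 - u / 2 * e) * (1 + k * u).
  by rewrite ler_wpM2r//; lra.
have ue0 : 0 <= u / 2 * e by rewrite mulr_ge0 ?ltW// divr_gt0.
have := mulr_ge0 ue0 ku0; lra.
Qed.

(** Up to the threshold the penalty is 1. On ]0, M] only a high rate allows s > 1/r, and then
    exp(-1/r) >= exp(-s). *)
Lemma damp_ge_expRN (r s : R) : 0 < s -> s <= M ->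
  expR (- s) <= (0 < s)%R%:R - amplitude r * (threshold r < s)%R%:R.
Proof.
move=> s0 sM; rewrite s0 /amplitude /threshold.
have s1 : expR (- s) <= 1 by rewrite expR_le1 oppr_le0 ltW.
case: ifP => _; first by rewrite ltNge sM mulr0 subr0.
case: ltP => us; last by rewrite mulr0 subr0.
by rewrite mulr1 subKr ler_expR lerN2 ltW.
Qed.

End damping_parameters.

Lemma uniform_bound_lt1 (R : realType) (X : eqType) (q : X -> R) (s : seq X) :
  (forall x, q x < 1) ->
  exists rho, [/\ 0 <= rho, rho < 1 & forall x, x \in s -> q x <= rho].
Proof.
move=> q1; elim: s => [|x s [rho [rho0 rho1 Hrho]]]; first by exists 0.
exists (Num.max (q x) rho); split.
- by rewrite le_max rho0 orbT.
- by rewrite gt_max q1.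
- by move=> y; rewrite in_cons le_max => /predU1P[->|/Hrho ->];
    rewrite ?lexx ?orbT.
Qed.

(** * Maximum principle for the iterates *)

Section lyapunov.
Context (R : realType) (X : countType) (Gam : X -> X -> R) (M : R).
Hypothesis Gam_Q : Qmatrix Gam.
Hypothesis M_ge1 : 1 <= M.

Definition amp (x : X) : R := amplitude R (gamma Gam x).
Definition thr (x : X) : R := threshold R M (gamma Gam x).

Lemma amp_ge0 x : 0 <= amp x.
Proof. by rewrite ltW// amplitude_gt0//; exact: gamma_gt0. Qed.

Lemma amp_le1 x : amp x <= 1.
Proof. exact: amplitude_le1. Qed.

Lemma thr_ge0 x : 0 <= thr x.
Proof. by apply: threshold_ge0 => //; exact: gamma_gt0. Qed.

Lemma damp_meanE x : damp_mean Gam amp thr x = mean_factor R M (gamma Gam x).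
Proof. by []. Qed.

Local Notation step := (damped_step Gam amp thr).

Lemma step_mean_ge0 x : 0 <= damp_mean Gam amp thr x.
Proof.
apply: damp_mean_ge0 => //; [exact: thr_ge0|exact: amp_ge0|exact: amp_le1].
Qed.

Lemma le_step (u v : X -> \bar R) x :
  (forall y, u y <= v y)%E -> (step u x <= step v x)%E.
Proof.
move=> uv; apply: le_esum => y _; apply: lee_wpmul2l => //.
by rewrite lee_fin mulr_ge0 ?step_mean_ge0// jumpP_ge0.
Qed.

Variables (V : X -> R) (K : R).
Hypothesis V_ge0 : forall x, 0 <= V x.
Hypothesis K_ge0 : 0 <= K.
Hypothesis V_gen : forall x,
  (\esum_(y in [set y | y != x]) (Gam x y * V y)%:E
     <= (gamma Gam x * V x + 1)%:E)%E.
Hypothesis V_fin : finite_set [set x | V x <> K].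

Lemma iter_step_le1 n x : (iter n step (cst 1%E) x <= 1)%E.
Proof.
elim: n x => [|n IHn] x //=.
apply: (le_trans (le_step _ (fun=> (0 * 0 + 1)%:E) x _)).
  by move=> y; rewrite mul0r add0r IHn.
apply: (le_trans (damped_step_affine _ _ _ Gam_Q _ _ (fun=> 0) _ _ _ _ _ _ _ _)) => //.
- exact: step_mean_ge0.
- rewrite esum1 ?lee_fin; last by move=> y _; rewrite mulr0.
  by rewrite mulr0 add0r ler01.
- rewrite mul0r add0r mulr1 lee_fin damp_meanE ltW// mean_factor_lt1//.
  exact: gamma_gt0.
Qed.

(* Off the finite set {V <> K} the bound exceeds 1; on it, one step multiplies the
   excess over the supersolution by at most rho. *)
Lemma iter_step_decay : exists rho, [/\ 0 <= rho, rho < 1 &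
  forall n x, (iter n step (cst 1%E) x <=
    ((1 + kappa R M * V x) / (1 + kappa R M * K) + rho ^+ n)%:E)%E].
Proof.
have k0 := kappa_gt0 R M M_ge1; set k := kappa R M in k0 *.
have [s Fs] := (finite_seqP _).1 V_fin.
have [rho [rho0 rho1 Hrho]] := uniform_bound_lt1 R X (damp_mean Gam amp thr) s
  (fun x => mean_factor_lt1 R M _ (gamma_gt0 _ _ _ Gam_Q x)).
exists rho; split => // n; set e := (1 + k * K)^-1.
have D0 : 0 < 1 + k * K by rewrite ltr_pwDl// mulr_ge0// ltW.
have e0 : 0 < e by rewrite invr_gt0.
have k0' := ltW k0.
elim: n => [|n IHn] x.
  by rewrite expr0 lee_fin lerDr mulr_ge0 ?ltW// ltr_pwDl// mulr_ge0.
have [VK|VK] := eqVneq (V x) K.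
  apply: (le_trans (iter_step_le1 _ _)).
  by rewrite lee_fin VK mulfV ?gt_eqF// lerDl exprn_ge0.
have xs : x \in s.
  by have : [set x | V x <> K] x by [apply/eqP]; rewrite Fs.
have q0 := step_mean_ge0 x; have q_le := Hrho _ xs.
rewrite iterS.
(* The inductive bound is put in the affine form b V + c. *)
apply: (le_trans (le_step _ (fun y => (k * e * V y + (e + rho ^+ n))%:E) x _)).
  by move=> y; rewrite (le_trans (IHn y))// lee_fin; lra.
apply: (le_trans (damped_step_affine _ _ _ Gam_Q _ _ V _ _ _ _ _ _ _ _)) => //.
- by rewrite mulr_ge0// ltW.
- by rewrite addr_ge0 ?exprn_ge0// ltW.
rewrite lee_fin exprS.
have g0 := gamma_gt0 _ _ _ Gam_Q x.
have qk : damp_mean Gam amp thr x * (1 + k / gamma Gam x) <= 1.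
  exact: mean_factor_kappa.
set q := damp_mean _ _ _ _ in q0 q_le qk *; set r := rho ^+ n.
have r0 : 0 <= r by rewrite exprn_ge0.
have h1 : q * r <= rho * r by rewrite ler_wpM2r.
(* U = 1 + kappa V is a supersolution: the terms 1 + k / gamma_x use [qk], the term k V(x) uses q <=
   1. *)
have h2 : q * (1 + k * V x + k / gamma Gam x) <= 1 + k * V x.
  have kV : 0 <= k * V x by rewrite mulr_ge0.
  have : q <= 1 by rewrite (le_trans q_le)// ltW.
  move=> /(ler_wpM2r kV); lra.
have := ler_wpM2l (ltW e0) h2; lra.
Qed.

End lyapunov.

(** * Non-explosion *)

Section explosion.
Context (R : realType) (X : countType) (Gam : X -> X -> R) (x0 : X) d
  (Omega : measurableType d) (Pr : probability Omega R)
  (xi : nat -> Omega -> X) (sig : nat -> Omega -> R).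
Hypothesis Gam_Q : Qmatrix Gam.
Hypothesis chain : is_CTMC Gam x0 Pr xi sig.

(** The law makes holding times positive only almost surely; on this event the partial sums up to
    [n] increase. *)
Definition holding_pos (n : nat) : set Omega :=
  [set w | forall k, (k < n)%N -> 0 < sig k w].

Lemma measurable_holding_pos n : measurable (holding_pos n).
Proof.
apply: (measurable_forall _ _ (fun k => k < n)%N (fun k => [set w | 0 < sig k w])).
by move=> k; exact: (measurable_late _ _ _ _ _ _ _ _ _ chain).
Qed.

Lemma undamped_step x :
  damped_step Gam (fun=> 0) (fun=> 0) (cst 1%E) x = 1%E.
Proof.
rewrite /damped_step.
under eq_esum => y _ do rewrite /damp_mean mul0r subr0 mul1r.
rewrite (esum_jumpP _ _ _ Gam_Q (cst 1%E))//.
under eq_esum => y _ do rewrite mule1.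
rewrite -/(gammaE Gam x) gammaEE// -EFinM mulVf// gt_eqF//.
exact: gamma_gt0.
Qed.

(** With amplitude and threshold 0 the penalty is the indicator of s > 0 and has mean 1, so
    [discount] is the indicator of this event and the iterates stay at 1. *)
Lemma holding_pos_prob n : Pr (holding_pos n) = 1%E.
Proof.
have := integral_discount _ _ Gam (fun=> 0) (fun=> 0) _ _ _ Pr _ _ chain
  (fun=> lexx 0) (fun=> lexx 0) (fun=> ler01) Gam_Q n.
have iter1 m : iter m (damped_step Gam (fun=> 0) (fun=> 0)) (cst 1%E) = cst 1%E.
  by elim: m => //= m ->; apply/funext => y; exact: undamped_step.
rewrite iter1 /= => <-.
have mH := measurable_holding_pos n.
transitivity (\int[Pr]_w (\1_(holding_pos n) w)%:E)%E.
  by rewrite integral_indic// setIT.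
apply: eq_integral => w _; congr EFin; rewrite /discount indicE.
under eq_bigr do rewrite /damp mul0r subr0.
case: (boolP (w \in _)) => [/set_mem h|].
  by rewrite big1// => k _; rewrite h.
rewrite notin_setE => nh.
have /existsP[k nk] : [exists k : 'I_n, ~~ (0 < sig k w)].
  apply: contrapT => /negP; rewrite negb_exists => /forallP h; apply: nh.
  by move=> k kn; have := h (Ordinal kn); rewrite negbK.
by rewrite (bigD1 k)//= (negbTE nk) mul0r.
Qed.

Lemma measurable_jump_time n : measurable_fun setT (fun w => \sum_(k < n) sig k w).
Proof. by apply: measurable_sum => k; have [_ [msig _]] := chain. Qed.

(** Markov inequality: on the event, [discount] is at least exp(-J_n) >= exp(-M). *)
Lemma early_jumps_prob (M : R) n : 1 <= M ->
  ((expR (- M))%:E *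
     Pr (holding_pos n `&` [set w | (\sum_(k < n) sig k w <= M)%R]) <=
   iter n (damped_step Gam (amp R X Gam) (thr R X Gam M)) (cst 1) x0)%E.
Proof.
move=> M1; set E := _ `&` _.
have t0 := thr_ge0 R X Gam M Gam_Q M1.
have a0 := amp_ge0 R X Gam Gam_Q.
have a1 := amp_le1 R X Gam.
have mE : measurable E.
  apply: measurableI; first exact: measurable_holding_pos.
  have := measurable_jump_time n measurableT `]-oo, M]%classic (measurable_itv _).
  by rewrite setTI; congr measurable; apply/seteqP; split=> w /=; rewrite in_itv.
have mZ := measurable_discount _ _ _ (amp R X Gam) (thr R X Gam M) _ _ _ _ _ _ chain n.
rewrite -(integral_discount _ _ _ _ _ _ _ _ Pr _ _ chain t0 a0 a1 Gam_Q n).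
rewrite -integral_cst//.
apply: (@le_trans _ _ (\int[Pr]_(w in E)
    (discount (amp R X Gam) (thr R X Gam M) xi sig n w)%:E)%E); last first.
  apply: ge0_subset_integral => //; first exact/measurable_EFinP.
  by move=> w _; rewrite lee_fin discount_ge0.
apply: ge0_le_integral => //.
- by move=> w _; rewrite lee_fin expR_ge0.
- by apply/measurable_EFinP; exact: measurable_funTS.
move=> w [pos /= JM]; rewrite lee_fin.
(* The penalty dominates exp(-s) only up to M; positivity of the other holding times puts each one
   in that range. *)
have sM (k : 'I_n) : sig k w <= M.
  apply: le_trans JM; rewrite (bigD1 k)//= lerDl sumr_ge0// => i _.
  by rewrite ltW// pos.
apply: (@le_trans _ _ (\prod_(k < n) expR (- sig k w))).
  rewrite -expR_sum ler_expR sumrN lerN2; exact: JM.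
apply: ler_prod => k _; rewrite expR_ge0 /=.
by apply: damp_ge_expRN => //; exact: pos.
Qed.

Lemma non_explosion_of_vanishing :
  (forall M : R, 1 <= M -> forall eps : R, 0 < eps -> exists n,
    (iter n (damped_step Gam (amp R X Gam) (thr R X Gam M)) (cst 1) x0
      <= eps%:E)%E) ->
  Pr [set w | forall M : R, exists N : nat, M < \sum_(k < N) sig k w] = 1%E.
Proof.
move=> small; set A := mkset _.
have mJ n (M : R) : measurable [set w | \sum_(k < n) sig k w <= M].
  have := measurable_jump_time n measurableT `]-oo, M]%classic (measurable_itv _).
  by rewrite setTI; congr measurable; apply/seteqP; split=> w /=; rewrite in_itv.
(* Horizons start at 1, as the penalties require. Off the event [A], either some holding time is not
   positive or some [B m] occurs. *)
pose B m := \bigcap_n (holding_pos n `&` [set w | \sum_(k < n) sig k w <= m.+1%:R]).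
have mB m : measurable (B m).
  apply: bigcapT_measurable => n; apply: measurableI => //.
  exact: measurable_holding_pos.
have B0 m : Pr (B m) = 0%E.
  apply/eqP; rewrite eq_le measure_ge0 andbT.
  apply/lee_addgt0Pr => eps eps0; rewrite add0e.
  have M1 : (1 : R) <= m.+1%:R by rewrite ler1n.
  have [|n Hn] := small _ M1 (expR (- m.+1%:R) * eps).
    by rewrite mulr_gt0 ?expR_gt0.
  have := le_trans (early_jumps_prob _ n M1) Hn.
  rewrite EFinM lee_pmul2l ?lte_fin ?expR_gt0//.
  apply: le_trans; apply: le_measure; rewrite ?inE//; last exact: bigcap_inf.
  by apply: measurableI => //; exact: measurable_holding_pos.
have Apos0 n : Pr (~` holding_pos n) = 0%E.
  rewrite probability_setC ?holding_pos_prob ?subee//.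
  exact: measurable_holding_pos.
pose C := (\bigcup_m B m) `|` (\bigcup_n ~` holding_pos n).
have C0 : Pr.-negligible C.
  have NB : Pr.-negligible (\bigcup_m B m).
    by apply: negligible_bigcup => m; apply/(negligibleP _ (mB m)); exact: B0.
  have NH : Pr.-negligible (\bigcup_n ~` holding_pos n).
    apply: (@negligible_bigcup _ _ _ _ (fun n => ~` holding_pos n)) => n.
    apply/(negligibleP _ (measurableC (measurable_holding_pos n))).
    exact: Apos0.
  exact: negligibleU.
have mA : measurable A.
  (* Integer levels suffice, which makes the intersection countable. *)
  rewrite (_ : A = \bigcap_m \bigcup_n ~` [set w | \sum_(k < n) sig k w <= m%:R]).
    apply: bigcapT_measurable => m; apply: bigcupT_measurable => n.
    exact: measurableC.
  apply/seteqP; split=> w h; first move=> m _.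
    by have [n hn] := h m%:R; exists n => //=; apply/negP; rewrite -ltNge.
  move=> M; have [n _ /= /negP] := h (Num.truncn M).+1 Logic.I.
  by rewrite -ltNge => hn; exists n; rewrite (lt_trans _ hn)// truncnS_gt.
have CA : ~` A `<=` C.
  move=> w /= nA; apply: contrapT => nC; apply: nA => M.
  apply: contrapT => noN; apply: nC.
  have [[n nn]|pos] := pselect (exists n, ~ holding_pos n w).
    by right; exists n.
  left; exists (Num.truncn M) => // n _; split.
    by apply: contrapT => nn; apply: pos; exists n.
  rewrite /= (le_trans _ (ltW (truncnS_gt _)))// leNgt; apply/negP => Mn.
  by apply: noN; exists n.
have A0 : Pr (~` A) = 0%E.
  apply/(negligibleP _ (measurableC mA)).
  exact: negligibleS CA C0.
by rewrite -[A]setCK probability_setC ?A0 ?sube0//; exact: measurableC.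
Qed.

End explosion.

Lemma geometric_small (R : realType) (rho eps : R) :
  0 <= rho -> rho < 1 -> 0 < eps -> exists n, rho ^+ n <= eps.
Proof.
move=> rho0 rho1 eps0.
have /cvgr0Pnorm_le/(_ _ eps0)[N _ HN] : (fun n => rho ^+ n) @ \oo --> (0 : R).
  by apply: cvg_expr; rewrite ger0_norm.
by exists N; have := HN N (leqnn N); rewrite /= ger0_norm ?exprn_ge0.
Qed.

Theorem theorem1p5 (R : realType) (X : countType) (Gam : X -> X -> R)
  (f : X -> R) (g : R -> R) :
  infinite_set [set: X] ->
  Qmatrix Gam ->
  irreducible Gam ->
  inDomPlus Gam f ->
  tends_to_infty f ->
  (forall y, 0 <= y -> 0 <= g y) ->
  (forall a b, 0 <= a -> a <= b -> g a <= g b) ->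
  (forall z, 0 <= z -> (Gint g z < +oo)%E) ->
  Gint g @ +oo --> +oo%E ->
  (forall x, genf Gam f x <= g (f x)) ->
  forall (x : X) d (Omega : measurableType d) (Pr : probability Omega R)
    (xi : nat -> Omega -> X) (sig : nat -> Omega -> R),
  is_CTMC Gam x Pr xi sig ->
  Pr [set w | forall M : R, exists N : nat, M < \sum_(k < N) sig k w] = 1%E.
Proof.
move=> _ Gam_Q _ f_dom f_infty g_ge0 g_incr Gint_fin Gint_infty gen_le
  x d Omega Pr xi sig chain.
have f_ge0 := f_dom.2.
(* Evaluating [g] at the right end of [j, j+1] gives s_j g(z) <= 1 on that interval; the summand 1
   keeps s_j <= 1, hence V <= f. *)
pose s (j : nat) : R := (1 + g j.+1%:R)^-1.
have s1_gt0 j : 0 < 1 + g j.+1%:R by rewrite ltr_pwDl// g_ge0.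
have s_ge0 j : 0 <= s j by rewrite invr_ge0 ltW.
have s_le1 j : s j <= 1 by rewrite invf_le1// lerDl g_ge0.
have s_decr i j : (i <= j)%N -> s j <= s i.
  by move=> ij; rewrite lef_pV2 ?posrE// lerD2l g_incr// ler_nat.
have s_g z : 0 <= z -> s (Num.truncn z) * g z <= 1.
  move=> z0; rewrite ler_pdivrMl// mulr1.
  rewrite (@le_trans _ _ (g (Num.truncn z).+1%:R))// ?lerDr//.
  by rewrite g_incr// ltW// truncnS_gt.
apply: (non_explosion_of_vanishing _ _ _ _ _ _ _ _ _ Gam_Q chain) => M M1 eps eps0.
have k0 := kappa_gt0 R M M1; set k := kappa R M in k0.
pose C := 1 + k * f x.
have C0 : 0 < C by rewrite ltr_pwDl// mulr_ge0// ltW.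
(* Since 1 + kappa V(x) <= C, a maximum K >= 2 C / (eps kappa) makes the first term of the decay
   bound at most eps / 2. *)
have [N KB] := slopes_diverge _ _ g_ge0 g_incr Gint_fin Gint_infty (2 * C / (eps * k)).
set K := \sum_(j < N) _ in KB.
have K0 : 0 <= K by apply: sumr_ge0 => j _; exact: s_ge0.
pose V y := clip_sum R s N (f y).
have V_fin : finite_set [set y | V y <> K].
  apply: sub_finite_set (f_infty N) => y /= VK.
  rewrite leNgt; apply/negP => /ltW Nf; apply: VK.
  exact: clip_sum_max.
have [rho [rho0 rho1 decay]] := iter_step_decay R X Gam M Gam_Q M1 V K
  (fun y => clip_sum_ge0 _ _ s_ge0 _ _) K0
  (fun y => gen_clip_sum _ _ _ Gam_Q f s N g y f_dom (gen_le y) s_ge0 s_decr s_g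
     (g_ge0 _ (f_ge0 y))) V_fin.
have [|n rho_n] := geometric_small _ _ (eps / 2) rho0 rho1.
  by rewrite divr_gt0.
exists n; apply: (le_trans (decay n x)); rewrite lee_fin -/k.
have D0 : 0 < 1 + k * K by rewrite ltr_pwDl// mulr_ge0// ltW.
have : (1 + k * V x) / (1 + k * K) <= eps / 2.
  rewrite ler_pdivrMr//; apply: (@le_trans _ _ C).
    by rewrite lerD2l ler_pM2l// clip_sum_le.
  have ek : 0 < eps * k by exact: mulr_gt0.
  move: KB; rewrite (ler_pdivrMr _ _ ek) => KB.
  by nra.
by lra.
Qed.
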